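(* Let $G$ be a countable monoid and let $X, Y$ be algebraic groups over an algebraically closed field $k$. Let $\Sigma \subset X(k)^G$ be a closed algebraic group subshift. Suppose that $\tau \colon \Sigma \to Y(k)^G$ is an injective algebraic group cellular automaton. Then for every subshift $\Delta \subset X(k)^G$ such that $\Delta \subset \Sigma$: $\tau(\Delta) \subset Y(k)^G$ is a subshift of finite type if and only if $\Delta$ is a subshift of finite type of $X(k)^G$; and $\tau(\Delta)$ is a sofic subshift if and only if $\Delta$ is a sofic subshift.
   Context: Let $G$ be a monoid and $A$ a set. $G$ acts on $A^G$ by $(g\star x)(h)=x(hg)$ for $g,h\in G$, $x\in A^G$. A subshift of $A^G$ is a $G$-invariant subset $\Sigma\subset A^G$ (i.e. $g\star x\in\Sigma$ for all $g\in G$, $x\in\Sigma$); it is not required to be closed. $A^G$ carries the prodiscrete topology (product of discrete topologies), and ''closed'' refers to this topology. For $E\subset G$, $\Sigma_E=\{x|_E : x\in\Sigma\}\subset A^E$. For $D\subset G$ finite and $P\subset A^D$, put $\Sigma(A^G;D,P)=\{x\in A^G : (g\star x)|_D\in P \text{ for all } g\in G\}$; the subsets of $A^G$ of this form are the subshifts of finite type of $A^G$. For sets $A,B$ and a subshift $\Sigma\subset A^G$, a map $\tau\colon\Sigma\to B^G$ is a cellular automaton if there are a finite set $M\subset G$ (memory set) and a map $\mu\colon\Sigma_M\to B$ (local defining map) with $\tau(x)(g)=\mu((g\star x)|_M)$ for all $x\in\Sigma$, $g\in G$. A subshift is sofic if it is the image of a subshift of finite type (of $C^G$ for some alphabet set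 $C$) under a cellular automaton. Let $A=X(k)$, $B=Y(k)$ for algebraic groups $X,Y$ over $k$. A subshift $\Sigma\subset A^G$ is a closed algebraic group subshift if it is closed and for every finite $E\subset G$ the restriction $\Sigma_E$ is an algebraic subgroup of $A^E$. For such $\Sigma$, a cellular automaton $\tau\colon\Sigma\to B^G$ is an algebraic group cellular automaton if it admits, for some finite memory set $M\subset G$, a local defining map $\mu\colon\Sigma_M\to B$ that is a $k$-homomorphism of algebraic groups. *)

(* Defs.v *)
From HB Require Import structures.
From mathcomp Require Import all_boot all_algebra finmap.
From mathcomp Require Import mpoly.
From mathcomp Require Import boolp classical_sets functions cardinality topology.

Set Implicit Arguments.
Unset Strict Implicit.
Unset Printing Implicit Defensive.

Import GRing.Theory.

Local Open Scope classical_set_scope.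
Local Open Scope ring_scope.

(** * Algebraic groups over an algebraically closed field, classically

    A variety over the algebraically closed field [k] is identified with its
    set of [k]-points, together with a finite atlas of affine charts whose
    changes of coordinates are regular (Weil, Serre).  Varieties need be neither
    affine nor irreducible.  Separatedness is not required: it is automatic for
    group varieties.  Nilpotents in a structure sheaf are invisible here; over
    an algebraically closed field, passing from a group scheme of finite type
    to its reduction changes neither the [k]-points, nor the closed subgroups
    of [k]-points, nor the homomorphisms out of such (reduced) subgroups. *)

Section Varieties.
Variable k : closedFieldType.

(** The affine space with coordinates indexed by [I] is [I -> k]. *)
Definition peval (I : finType) (p : {mpoly k[#|I|]}) (v : I -> k) : k :=
  p.@[fun t => v (enum_val t)].

Definition zero_locus (I : finType) (S : set {mpoly k[#|I|]}) : set (I -> k) :=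
  [set v | forall p, S p -> peval p v = 0].

(** [coord i] is only meaningful on [dom i]. *)
Record atlas (T : Type) := Atlas {
  chart : finType;
  dom : chart -> set T;
  coord_index : chart -> finType;
  coord : forall i : chart, T -> coord_index i -> k }.

Arguments dom {T a} i _.
Arguments coord_index {T a} i.
Arguments coord {T a} i _ _.

(** [f] is a morphism on the subset [Z] with its induced structure: around each
    point, in charts, it is given by quotients of polynomials.  Asking that
    nearby points of [Z] be sent to [dom j] expresses continuity.  The values of
    [f] outside [Z] play no role. *)
Definition regular_on (T U : Type) (a : atlas T) (b : atlas U)
    (Z : set T) (f : T -> U) : Prop :=
  forall (i : chart a) (j : chart b) (x : T), Z x -> dom i x -> dom j (f x) ->
  exists (P : coord_index j -> {mpoly k[#|coord_index i|]})
         (Q : {mpoly k[#|coord_index i|]}),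
    peval Q (coord i x) != 0 /\
    forall y, Z y -> dom i y -> peval Q (coord i y) != 0 ->
      dom j (f y) /\
      forall t, coord j (f y) t =
                peval (P t) (coord i y) / peval Q (coord i y).

(** Regularity of the identity says both that chart domains meet in Zariski open
    sets and that the changes of coordinates are regular. *)
Record is_variety (T : Type) (a : atlas T) : Prop := IsVariety {
  variety_cover : forall x, exists i : chart a, dom i x;
  variety_coord_inj : forall i : chart a, set_inj (dom i) (coord i);
  variety_coord_image : forall i : chart a,
    exists S, coord i @` dom i = zero_locus S;
  variety_compat : regular_on a a setT id }.

Definition zariski_closed (T : Type) (a : atlas T) (Z : set T) : Prop :=
  forall i : chart a, exists S,
    forall x, dom i x -> (Z x <-> zero_locus S (coord i x)).

Definition prod_atlas (T U : Type) (a : atlas T) (b : atlas U) :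
    atlas (T * U) :=
  @Atlas (T * U)%type (chart a * chart b)%type
    (fun c => [set x | dom c.1 x.1 /\ dom c.2 x.2])
    (fun c => (coord_index c.1 + coord_index c.2)%type)
    (fun c x t => match t with
                  | inl s => coord c.1 x.1 s
                  | inr s => coord c.2 x.2 s
                  end).

(** The power [T ^ E]; a chart is a choice of a chart of [T] for each factor. *)
Definition pow_atlas (E : finType) (T : Type) (a : atlas T) :
    atlas {ffun E -> T} :=
  @Atlas {ffun E -> T} {ffun E -> chart a}
    (fun c => [set x | forall e, dom (c e) (x e)])
    (fun c => {e : E & coord_index (c e)})
    (fun c x t => coord (c (tag t)) (x (tag t)) (tagged t)).

Record algGroup := AlgGroup {
  points :> groupType;
  points_atlas : atlas points;
  points_variety : is_variety points_atlas;
  points_mul_regular :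
    regular_on (prod_atlas points_atlas points_atlas) points_atlas setT
      (fun u => (u.1 * u.2)%g);
  points_inv_regular :
    regular_on points_atlas points_atlas setT (fun u => (u^-1)%g) }.

Definition algebraic_subgroup (T : groupType) (a : atlas T) (H : set T) :=
  [/\ H 1%g,
      forall u v, H u -> H v -> H (u * v)%g,
      forall u, H u -> H (u^-1)%g
    & zariski_closed a H].

(** [f] is a homomorphism of algebraic groups from the algebraic subgroup [H],
    with its reduced structure. *)
Definition alg_group_hom_on (T U : groupType) (a : atlas T) (b : atlas U)
    (H : set T) (f : T -> U) : Prop :=
  regular_on a b H f /\
  forall u v, H u -> H v -> f (u * v)%g = (f u * f v)%g.

End Varieties.

(** * Subshifts and cellular automata over a monoid

    A map defined on a set of configurations or of patterns is represented by a
    total function, only the values of which on that set are ever used. *)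

Section Shifts.
Variable G : monoidType.

Definition act (A : Type) (g : G) (x : G -> A) : G -> A :=
  fun h => x (h * g)%g.

Definition restr (A : Type) (E : {fset G}) (x : G -> A) : {ffun E -> A} :=
  [ffun h => x (val h)].

Definition subshift (A : Type) (Sigma : set (G -> A)) : Prop :=
  forall g x, Sigma x -> Sigma (act g x).

Definition sft (A : Type) (D : {fset G}) (P : set {ffun D -> A}) :
    set (G -> A) :=
  [set x | forall g, P (restr D (act g x))].

Definition is_sft (A : Type) (Sigma : set (G -> A)) : Prop :=
  exists (D : {fset G}) (P : set {ffun D -> A}), Sigma = sft P.

Definition local_rule (A B : Type) (Sigma : set (G -> A))
    (tau : (G -> A) -> (G -> B)) (M : {fset G}) (mu : {ffun M -> A} -> B) :=
  forall x, Sigma x -> forall g, tau x g = mu (restr M (act g x)).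

Definition cellular_automaton (A B : Type) (Sigma : set (G -> A))
    (tau : (G -> A) -> (G -> B)) : Prop :=
  exists (M : {fset G}) (mu : {ffun M -> A} -> B), local_rule Sigma tau mu.

Definition sofic (A : Type) (Sigma : set (G -> A)) : Prop :=
  exists (C : Type) (S : set (G -> C)) (tau : (G -> C) -> (G -> A)),
    [/\ is_sft S, cellular_automaton S tau & Sigma = tau @` S].

(** Closedness is for the topology of pointwise convergence, that is the
    product topology, with discrete factors. *)
Definition prodiscrete_closed (A : choiceType) (Sigma : set (G -> A)) : Prop :=
  closed (Sigma : set {ptws G -> discrete_topology A}).

Variable k : closedFieldType.

Definition closed_alg_group_subshift (X : algGroup k) (Sigma : set (G -> X)) :=
  [/\ subshift Sigma,
      prodiscrete_closed Sigma
    & forall E : {fset G},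
        algebraic_subgroup (pow_atlas E (points_atlas X))
          (@restr X E @` Sigma)].

Definition alg_group_cellular_automaton (X Y : algGroup k)
    (Sigma : set (G -> X)) (tau : (G -> X) -> (G -> Y)) : Prop :=
  exists (M : {fset G}) (mu : {ffun M -> X} -> Y),
    local_rule Sigma tau mu /\
    alg_group_hom_on (pow_atlas M (points_atlas X)) (points_atlas Y)
      (@restr X M @` Sigma) mu.

End Shifts.

(* Main.v *)
Require Import Defs.
From mathcomp Require Import all_boot all_order all_algebra finmap.
From mathcomp Require Import closed_field mpoly.
From mathcomp Require Import boolp classical_sets functions cardinality topology.

Set Implicit Arguments.
Unset Strict Implicit.
Unset Printing Implicit Defensive.

Import Order.Theory GRing.Theory.
Local Open Scope classical_set_scope.
Local Open Scope ring_scope.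
Local Notation coord i := (@Defs.coord _ _ _ i).

(** The whole theorem rests on one fact: the inverse of [tau] on its image is
    again given by a local rule ([inverse_local]).  Once both [tau] and its
    inverse are local, extend the two rules to total cellular automata [F] and
    [F'] on the full shifts.  Then [y] lies in the image of [Delta] exactly when
    [F' y] lies in [Delta] and [F (F' y) = y], and when [Delta] is of finite
    type both conditions can be checked through finite windows.  The situation
    is symmetric in [F] and [F'], and images of sofic subshifts are treated by
    composing automata ([ca_conjugacy]).

    Since [tau] is a homomorphism, locality of the inverse means that for some
    finite [N] every [x] in [Sigma] with [tau x = 1] on [N] satisfies [x 1 = 1]
    ([kernel_local]).  Exhaust [G] by finite sets [N n] and let [K n] be the
    group of those [x] in [Sigma] with [tau x = 1] on [N n].  The intersection
    of the [K n] is the kernel of [tau], hence trivial.  If no [N n] worked, each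
    [K n] would contain a point that is nontrivial at [1], and a nontrivial
    kernel element would be built by a Mittag-Leffler argument: it suffices
    that, for each finite window [E], the restrictions of the [K m] to [E]
    form a decreasing sequence that stabilises ([kernel_pattern_stable]).

    This is where algebraic geometry enters.  Zariski closed sets satisfy the
    descending chain condition ([zariski_dcc]), so it is enough that these
    restrictions be closed.  They are images of algebraic subgroups under
    coordinate projections between powers of [X].  By quantifier elimination
    over [k] such an image is constructible ([relabel_image_tame]), and a
    constructible subgroup is closed ([tame_subgroup_closed]): it contains a
    nonempty open part of its closure, and translates of that part fill the
    closure. *)

(** * Noetherianity of affine space *)

Lemma nondecreasing_subseq (u : nat -> nat) :
  exists phi : nat -> nat, {homo phi : i j / (i < j)%N} /\
    {homo u \o phi : i j / (i <= j)%N}.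
Proof.
have /choice[h hP] N : exists h, (N <= h)%N /\
    forall m, (N <= m)%N -> (u h <= u m)%N.
  pose Q v := `[< exists2 h, (N <= h)%N & u h = v >].
  have exQ : exists v, Q v by exists (u N); apply/asboolP; exists N.
  case: (ex_minnP exQ) => _ /asboolP[h leNh <-] minh.
  by exists h; split=> // m leNm; apply: minh; apply/asboolP; exists m.
pose phi i := iter i (fun x => h x.+1) (h 0%N).
exists phi; split.
  apply: homo_ltn; first by move=> ? ? ?; apply: ltn_trans.
  by move=> i; case: (hP (phi i).+1).
apply: homo_leq; [by []|by move=> y x z; apply: leq_trans|].
case=> [|i]; first by apply: (hP 0%N).2.
have [lt_i min_i] := hP (phi i).+1; apply: min_i.
by apply: leq_trans lt_i (ltnW _); case: (hP (phi i.+1).+1).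
Qed.

(** Pass to subsequences that are nondecreasing in one variable after another. *)
Lemma dickson n (u : nat -> 'X_{1..n}) :
  exists i j, (i < j)%N /\ (u i <= u j)%MM.
Proof.
have [phi [phi_mono phi_u]] : exists phi : nat -> nat,
    {homo phi : i j / (i < j)%N} /\
    forall t, t \in enum 'I_n -> {homo (fun i => u (phi i) t) : i j / (i <= j)%N}.
  elim: (enum 'I_n) => [|t s [phi [phi_mono phi_u]]]; first by exists id; split.
  have [psi [psi_mono psi_u]] := nondecreasing_subseq (fun i => u (phi i) t).
  exists (phi \o psi); split=> [i j ltij|t']; first exact/phi_mono/psi_mono.
  rewrite inE => /predU1P[->|t's]; first exact: psi_u.
  move=> i j; rewrite leq_eqVlt => /predU1P[->//|/psi_mono/ltnW].
  exact: (phi_u _ t's).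
exists (phi 0%N), (phi 1%N); split; first exact: phi_mono.
by apply/mnm_lepP => t; apply: (phi_u t) => //; rewrite mem_enum.
Qed.

(** Hilbert's basis theorem, in the form in which it is used.  The ideals of
    polynomials vanishing at all [v j] with [j > N] increase with [N].  If the
    conclusion failed, let [g N] have least leading monomial among the members
    of the [N]-th ideal that do not vanish at [v N].  Dickson's lemma provides
    [i < j] such that the leading monomial of [g i] divides that of [g j];
    as [g i] vanishes at [v j] and beyond, cancelling the leading term of [g j]
    by a multiple of [g i] contradicts the minimality of [g j]. *)
Lemma noetherian_seq (F : fieldType) n (f : nat -> {mpoly F[n]})
    (v : nat -> 'I_n -> F) :
  (forall i j, (i < j)%N -> (f i).@[v j] = 0) -> exists j, (f j).@[v j] = 0.
Proof.
move=> f0; apply: contrapT => /forallNP fN0.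
pose J N (p : {mpoly F[n]}) :=
  (forall j, (N < j)%N -> p.@[v j] = 0) /\ p.@[v N] <> 0.
have /choice[g gP] N : exists g, J N g /\
    forall q, J N q -> (mlead g <= mlead q)%O.
  have: J N (f N) by split=> // j; apply: f0.
  move: {2}(mlead (f N)) (erefl (mlead (f N))) => m.
  elim/(well_founded_ind (@ltom_wf n)): m (f N) => m IH p pm Jp.
  have [min_p|/existsNP[q]] := pselect (forall q, J N q -> (mlead p <= mlead q)%O).
    by exists p.
  case/not_implyP=> Jq /negP; rewrite -ltNge pm => ltq.
  exact: (IH _ ltq q).
have [i [j [ltij le_m]]] := dickson (fun i => mlead (g i)).
have [[gi0 giN0] _] := gP i; have [[gj0 gjN0] min_j] := gP j.
have gi_nz : g i != 0 by apply/eqP => g0; apply: giN0; rewrite g0 meval0.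
pose m := (mlead (g j) - mlead (g i))%MM.
pose c := mleadc (g j) / mleadc (g i).
pose q := g j - c *: 'X_[m] * g i.
have qE t : q.@[v t] = (g j).@[v t] - (c *: 'X_[m]).@[v t] * (g i).@[v t].
  by rewrite /q mevalB mevalM.
have Jq : J j q.
  split=> [t ltjt|]; rewrite qE gi0 ?mulr0 ?subr0 //; last exact: ltn_trans ltjt.
  exact: gj0.
have q_nz : q != 0 by apply/eqP => q0; case: Jq => _; rewrite q0 meval0.
have m_add : (m + mlead (g i))%MM = mlead (g j) by rewrite /m submK.
have le_lead : (mlead (c *: 'X_[m] * g i) <= mlead (g j))%O.
  apply: le_trans (mleadM_le _ _) _; rewrite -m_add lemc_add2l.
  by apply: le_trans (mleadZ_le _ _) _; rewrite mleadXm.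
have q_lead : q@_(mlead (g j)) = 0.
  have -> : q = g j - c *: (g i * 'X_[m]) by rewrite /q -scalerAl commr_mpolyX.
  rewrite mcoeffB mcoeffZ -{2}m_add mcoeffMX /c divfK ?subrr //.
  by rewrite mleadc_eq0.
have lead_le : (mlead q <= mlead (g j))%O.
  by apply: le_trans (mleadB_le _ _) _; rewrite leUx lexx.
have lead_eq : mlead q = mlead (g j).
  by apply/eqP; rewrite eq_le lead_le min_j.
by move: q_nz; rewrite -mleadc_eq0 lead_eq q_lead eqxx.
Qed.

(** * Elimination over an algebraically closed field *)

Section Elimination.
Variable k : closedFieldType.

Lemma zero_locus_finite (I : finType) (S : set {mpoly k[#|I|]}) :
  exists s : seq {mpoly k[#|I|]},
    forall v, zero_locus S v <-> {in s, forall p, peval p v = 0}.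
Proof.
apply: contrapT => /forallNP noS.
have /choice[f fP] (s : seq {p | S p}) : exists pv : {p | S p} * (I -> k),
    {in map sval s, forall q, peval q pv.2 = 0} /\ peval (sval pv.1) pv.2 <> 0.
  apply: contrapT => /forallNP H; apply: (noS (map sval s)) => v.
  split=> [Zv q|Zs p Sp].
    elim: s {H} => // -[p Sp] s IH; rewrite inE => /predU1P[->|/IH//].
    exact: Zv.
  by apply: contrapT => pv; apply: (H (exist _ p Sp, v)).
pose l n := iter n (fun s => (f s).1 :: s) [::].
have lP i j : (i < j)%N -> sval (f (l i)).1 \in map sval (l j).
  elim: j => // j IH; rewrite ltnS leq_eqVlt inE => /predU1P[->|/IH->].
    by rewrite eqxx.
  by rewrite orbT.
have [|j] := @noetherian_seq k _ (fun n => sval (f (l n)).1)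
  (fun n t => (f (l n)).2 (enum_val t)).
  by move=> i j /lP; apply: (fP _).1.
exact: (fP (l j)).2.
Qed.

Definition env (I : finType) (v : I -> k) : seq k := map v (enum I).

Lemma size_env (I : finType) (v : I -> k) : size (env v) = #|I|.
Proof. by rewrite size_map -cardE. Qed.

Lemma nth_env (I : finType) (v : I -> k) (t : 'I_#|I|) :
  (env v)`_t = v (enum_val t).
Proof.
rewrite (nth_map (enum_val t)) -?cardE ?ltn_ord //.
by rewrite -enum_val_nth.
Qed.

(** The shift [m] leaves room for the free variables of a formula before the
    variables of [p]. *)
Lemma rterm_of_mpoly n (p : {mpoly k[n]}) (m : nat) :
  exists t, GRing.rterm t /\
    forall e : seq k, GRing.eval e t = p.@[fun i => e`_(m + i)].
Proof.
pose repr (p : {mpoly k[n]}) := exists t, GRing.rterm t /\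
    forall e : seq k, GRing.eval e t = p.@[fun i => e`_(m + i)].
have reprM q r : repr q -> repr r -> repr (q * r).
  move=> [t [rt tP]] [u [ru uP]]; exists (GRing.Mul t u); split=> /= [|e].
    by rewrite rt.
  by rewrite mevalM tP uP.
have reprC c : repr c%:MP.
  by exists (GRing.Const c); split=> // e; rewrite mevalC.
have reprX i : repr 'X_i.
  by exists (GRing.Var _ (m + i)); split=> // e; rewrite mevalXU.
elim/mpolyind: p => [|c mm p _ _ [t [rt tP]]].
  by rewrite -mpolyC0; apply: reprC.
have [u [ru uP]] : repr (c *: 'X_[mm]).
  rewrite -mul_mpolyC; apply: (reprM) => //; rewrite mpolyXE_id.
  apply: (big_ind repr _ reprM) => [|i _]; first exact: (reprC 1).
  elim: (mm i) => [|d IH]; first by rewrite expr0; apply: (reprC 1).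
  by rewrite exprS; apply: reprM.
exists (GRing.Add u t); split=> /= [|e]; first by rewrite ru.
by rewrite mevalD tP uP.
Qed.

Lemma mpoly_of_rterm (I : finType) (t : GRing.term k) : GRing.rterm t ->
  exists p : {mpoly k[#|I|]}, forall v, GRing.eval (env v) t = peval p v.
Proof.
rewrite /peval; elim: t => //=.
- move=> i _; have [lti|lei] := ltnP i #|I|.
    by exists 'X_(Ordinal lti) => v; rewrite mevalXU -nth_env.
  by exists 0 => v; rewrite meval0 nth_default // size_map -cardE.
- by move=> c _; exists c%:MP => v; rewrite mevalC.
- by move=> n _; exists n%:R => v; rewrite -mpolyC_nat mevalC.
- move=> t IHt u IHu /andP[/IHt[p pP] /IHu[q qP]].
  by exists (p + q) => v; rewrite mevalD pP qP.
- by move=> t IHt /IHt[p pP]; exists (- p) => v; rewrite mevalN pP.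
- by move=> t IHt n /IHt[p pP]; exists (p *+ n) => v; rewrite mevalMn pP.
- move=> t IHt u IHu /andP[/IHt[p pP] /IHu[q qP]].
  by exists (p * q) => v; rewrite mevalM pP qP.
- by move=> t IHt n /IHt[p pP]; exists (p ^+ n) => v; rewrite rmorphXn /= pP.
Qed.

(** Chevalley's theorem in affine space: the vectors [w] occupy the free
    variables [0 .. #|I| - 1], and the points [v] of the zero locus the
    quantified variables that follow. *)
Lemma projection_qf (I J : finType) (iota : I -> J)
    (S : set {mpoly k[#|J|]}) :
  exists f : GRing.formula k, GRing.qf_form f && GRing.rformula f /\
    forall w : I -> k, GRing.qf_eval (env w) f <->
      exists2 v, zero_locus S v & w = v \o iota.
Proof.
have [s sP] := zero_locus_finite S; pose n := #|I|.
have /choice[T TP] (p : {mpoly k[#|J|]}) := rterm_of_mpoly p n.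
pose var i := GRing.Var k i.
pose F1 := \big[GRing.And/GRing.Bool true]_(p <- s)
   GRing.Equal (T p) (GRing.Const 0).
pose F2 := \big[GRing.And/GRing.Bool true]_(i <- enum I)
   GRing.Equal (var (enum_rank i)) (var (n + enum_rank (iota i))%N).
have holds_And (A : eqType) (r : seq A) (f : A -> GRing.formula k) e :
    GRing.holds e (\big[GRing.And/GRing.Bool true]_(a <- r) f a) <->
    forall a, a \in r -> GRing.holds e (f a).
  elim: r => [|a r IH]; first by rewrite big_nil.
  rewrite big_cons /= IH; split=> [[fa fr] b|fr].
    by rewrite inE => /predU1P[->//|/fr].
  by split=> [|b br]; apply: fr; rewrite inE ?eqxx ?br ?orbT.
have rform_And (A : Type) (r : seq A) (f : A -> GRing.formula k) :
    (forall a, GRing.rformula (f a)) ->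
    GRing.rformula (\big[GRing.And/GRing.Bool true]_(a <- r) f a).
  by move=> fP; apply: (big_ind (@GRing.rformula k)) => //= g h -> ->.
pose f := foldr GRing.Exists (GRing.And F1 F2) (seq.iota n #|J|).
have rf : GRing.rformula f.
  rewrite /f; elim: (seq.iota _ _) => //=.
  by rewrite !rform_And // => p; rewrite /= (TP p).1.
pose qf := GRing.quantifier_elim (@ClosedFieldQE.ex_elim k) f.
have qfP e : reflect (GRing.holds e f) (GRing.qf_eval e qf).
  apply: GRing.quantifier_elim_rformP => //.
    exact: ClosedFieldQE.wf_ex_elim.
  exact/ClosedFieldQE.holds_ex_elim/GRing.solve_monicpoly.
exists qf; split=> [|w].
  by apply: GRing.quantifier_elim_wf => //; apply: ClosedFieldQE.wf_ex_elim.
split=> [/qfP|[v Zv wE]].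
  move=> /GRing.foldExistsP[e' ew [/holds_And F1e /holds_And F2e]].
  exists (fun j => e'`_(n + enum_rank j)).
    apply/sP => p ps; have := F1e p ps; rewrite /= (TP p).2 => F1p.
    by rewrite -[RHS]F1p; apply: meval_eq => t; rewrite enum_valK.
  apply: funext => i /=; have := F2e i (mem_enum _ _) => /= <-.
  rewrite -(ew (enum_rank i)) ?nth_env ?enum_rankK //.
  by rewrite !inE mem_iota negb_and -ltnNge ltn_ord.
apply/qfP/GRing.foldExistsP; exists (env w ++ env v).
  move=> i; rewrite !inE mem_iota negb_and -ltnNge -leqNgt nth_cat size_env.
  case: ltnP => //= lei lei'.
  by rewrite !nth_default ?size_env ?leq_subRL //.
have nth_v t : (env w ++ env v)`_(n + t) = (env v)`_t.
  by rewrite nth_cat size_env ltnNge leq_addr /= addKn.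
split; [apply/holds_And => p ps|apply/holds_And => i _] => /=.
  rewrite (TP p).2 -[RHS]((sP v).1 Zv p ps).
  by apply: meval_eq => t; rewrite nth_v nth_env.
rewrite nth_v nth_env enum_rankK nth_cat size_env ltn_ord nth_env.
by rewrite enum_rankK wE.
Qed.

End Elimination.

(** * The Zariski topology of a variety *)

Section Substitution.
Variable k : closedFieldType.

Lemma peval_subst (I J : finType) (sigma : J -> {mpoly k[#|I|]})
    (p : {mpoly k[#|J|]}) : exists q : {mpoly k[#|I|]},
  forall v, peval q v = peval p (fun j => peval (sigma j) v).
Proof.
exists (p \mPo [tuple sigma (enum_val t) | t < #|J|]) => v.
rewrite /peval comp_mpoly_meval; apply: meval_eq => t.
by rewrite tnth_mktuple.
Qed.

Lemma pevalM (I : finType) (p q : {mpoly k[#|I|]}) v :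
  peval (p * q) v = peval p v * peval q v.
Proof. exact: mevalM. Qed.

Lemma pevalX (I : finType) (i : I) (v : I -> k) :
  peval 'X_(enum_rank i) v = v i.
Proof. by rewrite /peval mevalXU enum_rankK. Qed.

Lemma peval_rename (I J : finType) (iota : J -> I) (p : {mpoly k[#|J|]}) :
  exists q : {mpoly k[#|I|]}, forall v, peval q v = peval p (v \o iota).
Proof.
have [q qP] := peval_subst (fun j => 'X_(enum_rank (iota j))) p.
by exists q => v; rewrite qP; apply: meval_eq => t; rewrite pevalX.
Qed.

(** A high enough power of [Q] clears the denominators of [p] evaluated at the
    fractions [P j / Q]; where [Q] does not vanish this does not change
    the zeros. *)
Lemma peval_fraction (I J : finType) (P : J -> {mpoly k[#|I|]})
    (Q : {mpoly k[#|I|]}) (p : {mpoly k[#|J|]}) :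
  exists h : {mpoly k[#|I|]}, forall v, peval Q v != 0 ->
    (peval h v != 0) = (peval p (fun j => peval (P j) v / peval Q v) != 0).
Proof.
pose frac v j := peval (P j) v / peval Q v.
pose num (p : {mpoly k[#|J|]}) := exists N (h : {mpoly k[#|I|]}),
  forall v, peval Q v != 0 -> peval h v = peval Q v ^+ N * peval p (frac v).
suff [N [h hP]] : num p.
  exists h => v Qv; rewrite hP // mulf_eq0 negb_or expf_eq0.
  by rewrite (negPf Qv) andbF.
have numM q r : num q -> num r -> num (q * r).
  move=> [N [h hP]] [M [g gP]]; exists (N + M)%N, (h * g) => v Qv.
  by rewrite /peval !mevalM -!/(peval _ _) hP // gP // exprD mulrACA.
have numC c : num c%:MP.
  by exists 0%N, c%:MP => v _; rewrite /peval !mevalC expr0 mul1r.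
have numX j : num 'X_j.
  exists 1%N, (P (enum_val j)) => v Qv.
  by rewrite /peval mevalXU expr1 mulrC divfK.
elim/mpolyind: p => [|c m p _ _ [N [h hP]]].
  by rewrite -mpolyC0; apply: numC.
have [M [g gP]] : num (c *: 'X_[m]).
  rewrite -mul_mpolyC; apply: (numM); first exact: numC.
  rewrite mpolyXE_id; apply: (big_ind num _ numM) => [|i _]; first exact: (numC 1).
  elim: (m i) => [|d IH]; first by rewrite expr0; apply: (numC 1).
  by rewrite exprS; apply: numM.
exists (M + N)%N, (Q ^+ N * g + Q ^+ M * h) => v Qv.
rewrite /peval !(mevalD, mevalM, rmorphXn) /= -!/(peval _ _) gP // hP //.
by rewrite mulrDr exprD mulrA [X in _ = X * _ + _]mulrC mulrA.
Qed.

End Substitution.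

Section ZariskiTopology.
Variables (k : closedFieldType) (T : Type) (a : atlas k T).
Hypothesis aV : is_variety a.

Definition basic_open (i : chart a) (p : {mpoly k[#|coord_index i|]}) : set T :=
  [set x | dom i x /\ peval p (coord i x) != 0].

Arguments basic_open i p _ : clear implicits.

Definition zariski_open (O : set T) : Prop :=
  forall x, O x -> forall i : chart a, dom i x ->
  exists2 p, basic_open i p x & basic_open i p `<=` O.

Lemma zariski_openC O : zariski_open O <-> zariski_closed a (~` O).
Proof.
split=> [openO i|closedO x Ox i ix].
  exists [set p | forall y, dom i y -> ~ O y -> peval p (coord i y) = 0].
  move=> x ix; split=> [nOx p /(_ x ix nOx)//|Zx Ox].
  have [p [_ /eqP px] pO] := openO x Ox i ix.
  apply: px; apply: Zx => y iy nOy; apply: contrapT => /eqP py.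
  by apply: nOy; apply: pO.
have [S SP] := closedO i.
have /existsNP[p /not_implyP[Sp /eqP px]] : ~ zero_locus S (coord i x).
  by move/(SP x ix).
exists p => // y [iy /eqP py]; apply: contrapT => nOy.
by apply: py; apply: ((SP y iy).1 nOy).
Qed.

Lemma zariski_closedC Z : zariski_closed a Z <-> zariski_open (~` Z).
Proof. by rewrite zariski_openC setCK. Qed.

Lemma zariski_openT : zariski_open setT.
Proof.
by move=> x _ i ix; exists 1 => //; split=> //; rewrite /peval meval1 oner_neq0.
Qed.

Lemma zariski_openI O1 O2 :
  zariski_open O1 -> zariski_open O2 -> zariski_open (O1 `&` O2).
Proof.
move=> o1 o2 x [O1x O2x] i ix.
have [p [_ px] pO] := o1 x O1x i ix; have [q [_ qx] qO] := o2 x O2x i ix.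
exists (p * q); first by split=> //; rewrite pevalM mulf_neq0.
move=> y [iy]; rewrite /peval mevalM mulf_eq0 negb_or => /andP[py qy].
by split; [apply: pO|apply: qO].
Qed.

Lemma zariski_open_bigcup (J : Type) (D : set J) (O : J -> set T) :
  (forall j, D j -> zariski_open (O j)) -> zariski_open (\bigcup_(j in D) O j).
Proof.
move=> oO x [j Dj Ox] i ix; have [p px pO] := oO j Dj x Ox i ix.
by exists p => // y /pO; exists j.
Qed.

Lemma zariski_closed_bigcap (J : Type) (D : set J) (Z : J -> set T) :
  (forall j, D j -> zariski_closed a (Z j)) ->
  zariski_closed a (\bigcap_(j in D) Z j).
Proof.
move=> cZ; apply/zariski_closedC; rewrite setC_bigcap.
by apply: zariski_open_bigcup => j /cZ/zariski_closedC.
Qed.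

Lemma zariski_closedI Z1 Z2 : zariski_closed a Z1 -> zariski_closed a Z2 ->
  zariski_closed a (Z1 `&` Z2).
Proof.
move=> c1 c2; rewrite -bigcap2E; apply: zariski_closed_bigcap => -[|[|n]] //= _.
by apply/zariski_closedC; rewrite setCT => ?.
Qed.

Lemma zariski_closed1 x : zariski_closed a [set x].
Proof.
move=> i; have [ix|nix] := pselect (dom i x).
  exists [set p | peval p (coord i x) = 0] => y iy; split=> [-> //|Zy] /=.
  apply: (variety_coord_inj aV (i := i)); rewrite ?in_setE //.
  apply: funext => t; apply/eqP; rewrite -subr_eq0; apply/eqP.
  have := Zy ('X_(enum_rank t) - (coord i x t)%:MP) => /=.
  rewrite /peval !mevalB !mevalC !mevalXU !enum_rankK; apply.
  by rewrite subrr.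
exists setT => y iy; split=> [yx|/(_ 1 I)]; first by case: nix; rewrite -yx.
by rewrite /peval meval1 => /eqP; rewrite oner_eq0.
Qed.

(** On one chart, a chain that never stabilises gives points in some [Z N] but
    not in a later term, each with a polynomial separating it from that later
    term; this contradicts [noetherian_seq].  There are finitely many charts. *)
Lemma zariski_dcc (Z : nat -> set T) :
  (forall n, zariski_closed a (Z n)) -> (forall n, Z n.+1 `<=` Z n) ->
  exists N, forall n, (N <= n)%N -> Z N `<=` Z n.
Proof.
move=> cZ decZ.
have subZ m n : (m <= n)%N -> Z n `<=` Z m.
  move=> /subnK <-; elim: (n - m)%N => // d IH; exact: subset_trans (decZ _) IH.
suff /choice[N NP] (i : chart a) : exists N, forall n, (N <= n)%N ->
    Z N `&` dom i `<=` Z n.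
  exists (\max_i N i) => n leNn x Zx; have [i ix] := variety_cover aV x.
  have leN := @leq_bigmax _ N i.
  by apply: (NP i n (leq_trans leN leNn) x); split=> //; apply: subZ Zx.
apply: contrapT => /forallNP noN.
have /choice[f fP] N : exists f : nat * T * {mpoly k[#|coord_index i|]},
   [/\ (N <= f.1.1)%N, Z N f.1.2, dom i f.1.2, peval f.2 (coord i f.1.2) <> 0
     & forall y, Z f.1.1 y -> dom i y -> peval f.2 (coord i y) = 0].
  have /existsNP[n /not_implyP[leNn /existsNP[x]]] := noN N.
  move=> /not_implyP[[Zx ix] nZx].
  have [p [_ /eqP px] pZ] := (zariski_closedC (Z n)).1 (cZ n) x nZx i ix.
  exists (n, x, p); split=> //= y Zy iy; apply: contrapT => /eqP py.
  exact: (pZ y).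
pose l n := iter n (fun N => (f N).1.1) 0%N.
have l_le : {homo l : m n / (m <= n)%N}.
  by apply: homo_leq => [//|y x z|j]; [exact: leq_trans|case: (fP (l j))].
have [j j'|j] := @noetherian_seq k _ (fun n => (f (l n)).2)
  (fun n t => coord i (f (l n)).1.2 (enum_val t)).
  move=> ltjj'; have [_ _ _ _] := fP (l j); apply.
    by have [_ Zx _ _ _] := fP (l j'); apply: subZ Zx; apply: (l_le j.+1 j').
  by case: (fP (l j')).
by case: (fP (l j)).
Qed.

End ZariskiTopology.
Arguments basic_open [k T a] i p _.

Section Regular.
Variables (k : closedFieldType) (T U : Type) (a : atlas k T) (b : atlas k U).
Hypothesis bV : is_variety b.

(** Quotients of polynomials pull principal open sets back to principal open
    sets, after clearing denominators. *)
Lemma regular_basic_open (Z : set T) (f : T -> U) x (i : chart a) (j : chart b)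
    (p : {mpoly k[#|coord_index j|]}) :
  regular_on a b Z f -> Z x -> dom i x -> basic_open j p (f x) ->
  exists2 q, basic_open i q x &
    forall y, Z y -> basic_open i q y -> basic_open j p (f y).
Proof.
move=> fZ Zx ix [jfx px]; have [P [Q [Qx PQ]]] := fZ i j x Zx ix jfx.
have [h hP] := peval_fraction P Q p.
have coordE y : Z y -> dom i y -> peval Q (coord i y) != 0 ->
    coord j (f y) = (fun t => peval (P t) (coord i y) / peval Q (coord i y)).
  by move=> Zy iy Qy; apply: funext => t; apply: (PQ y Zy iy Qy).2.
exists (Q * h); first by split=> //; rewrite pevalM mulf_neq0 // hP // -coordE.
move=> y Zy [iy]; rewrite pevalM mulf_eq0 negb_or => /andP[Qy].
by rewrite hP // -coordE // => py; split=> //; apply: (PQ y Zy iy Qy).1.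
Qed.

Lemma regular_pullback (Z : set T) (f : T -> U) (O : set U) x (i : chart a) :
  regular_on a b Z f -> zariski_open b O -> Z x -> O (f x) -> dom i x ->
  exists2 p, basic_open i p x &
    forall y, Z y -> basic_open i p y -> O (f y).
Proof.
move=> fZ oO Zx Ofx ix; have [j jfx] := variety_cover bV (f x).
have [p px pO] := oO _ Ofx j jfx.
have [q qx qP] := regular_basic_open fZ Zx ix px.
by exists q => // y Zy /(qP y Zy)/pO.
Qed.

Lemma regular_preimage_closed (Z : set T) (f : T -> U) (C : set U) :
  regular_on a b Z f -> zariski_closed a Z -> zariski_closed b C ->
  zariski_closed a (Z `&` f @^-1` C).
Proof.
move=> fZ cZ /zariski_closedC oC; apply/zariski_closedC => x nx i ix.
have [Zx|nZx] := pselect (Z x).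
  have nCx : ~ C (f x) by move=> Cx; apply: nx.
  have [p px pC] := regular_pullback fZ oC Zx nCx ix.
  by exists p => // y py [Zy]; apply: pC.
have [p px pZ] := (zariski_closedC a Z).1 cZ x nZx i ix.
by exists p => // y /pZ nZy [].
Qed.

Lemma regular_continuous (f : T -> U) (C : set U) :
  regular_on a b setT f -> zariski_closed b C -> zariski_closed a (f @^-1` C).
Proof.
move=> fT cC; rewrite -[_ @^-1` _]setTI; apply: regular_preimage_closed => //.
by apply/zariski_closedC; rewrite setCT => ?.
Qed.

End Regular.

Lemma basic_open_open (k : closedFieldType) (T : Type) (a : atlas k T)
    (aV : is_variety a) (i : chart a) p : zariski_open a (basic_open i p).
Proof.
move=> x px j jx.
have [q qx qP] := regular_basic_open (variety_compat aV) Logic.I jx px.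
by exists q => // y; apply: qP.
Qed.

(** * Powers and translations *)

Section Powers.
Variable k : closedFieldType.

(** One statement for the maps needed between powers: translations and
    inversion (with [s] the identity) and reindexing (with [f] the identity).
    The denominators of the coordinates are multiplied together to obtain a
    common one. *)
Lemma pow_regular (E F : finType) (T U : Type) (a : atlas k T) (b : atlas k U)
    (s : F -> E) (f : F -> T -> U) :
  (forall h, regular_on a b setT (f h)) ->
  regular_on (pow_atlas E a) (pow_atlas F b) setT
    (fun x => [ffun h => f h (x (s h))]).
Proof.
move=> f_reg c d x _ /= cx dfx.
pose c' : chart (pow_atlas E a) := c.
have loc h : exists PQ : (coord_index (d h) -> {mpoly k[#|coord_index c'|]})
      * {mpoly k[#|coord_index c'|]},
    peval PQ.2 (coord c' x) != 0 /\
    forall y, dom c' y -> peval PQ.2 (coord c' y) != 0 ->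
      dom (d h) (f h (y (s h))) /\
      forall t, coord (d h) (f h (y (s h))) t =
        peval (PQ.1 t) (coord c' y) / peval PQ.2 (coord c' y).
  have dfxh := dfx h; rewrite ffunE in dfxh.
  have [P [Q [Qx PQ]]] :=
    f_reg h (c (s h)) (d h) (x (s h)) Logic.I (cx (s h)) dfxh.
  pose iota (t : coord_index (c (s h))) : coord_index c' :=
    Tagged (fun e => coord_index (c e)) t.
  have [Q' Q'P] := peval_rename iota Q.
  have /choice[P' P'P] t := peval_rename iota (P t).
  exists (P', Q'); rewrite /= Q'P; split=> // y cy; rewrite Q'P => Qy.
  have [dfy fyE] := PQ (y (s h)) Logic.I (cy (s h)) Qy; split=> // t.
  by rewrite P'P fyE.
have {}loc h := cid (loc h).
pose P h := (sval (loc h)).1; pose Q h := (sval (loc h)).2.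
have pevalQ v (D : pred F) :
    peval (\prod_(h | D h) Q h) v = \prod_(h | D h) peval (Q h) v.
  by rewrite /peval rmorph_prod.
exists (fun t => P (tag t) (tagged t) * \prod_(h | h != tag t) Q h), (\prod_h Q h).
split=> [|y _ cy].
  by rewrite (pevalQ _ xpredT); apply/prodf_neq0 => h _; apply: (svalP (loc h)).1.
rewrite (pevalQ _ xpredT) => /prodf_neq0 Qy.
have yP h := (svalP (loc h)).2 y cy (Qy h isT).
split=> [h|[h t]] /=; rewrite ffunE; first exact: (yP h).1.
rewrite (yP h).2 pevalM (pevalQ _ (fun h' => h' != h)).
rewrite [X in _ = _ / X](bigD1 h) //=.
rewrite -mulf_div divff ?mulr1 //; apply/prodf_neq0 => h' _; exact: Qy.
Qed.

Lemma pow_variety (E : finType) (T : Type) (a : atlas k T) :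
  is_variety a -> is_variety (pow_atlas E a).
Proof.
move=> aV; split.
- move=> x; have /choice[c cP] e := variety_cover aV (x e).
  by exists [ffun e => c e] => e; rewrite ffunE.
- move=> c x y; rewrite !in_setE => cx cy xy; apply/ffunP => e.
  apply: (variety_coord_inj aV (i := c e)); rewrite ?in_setE //.
  apply: funext => t.
  exact: (congr1 (fun v => v (Tagged (fun e => coord_index (c e)) t)) xy).
- move=> c; have S_ e := cid (variety_coord_image aV (c e)).
  pose S e := sval (S_ e).
  have SP e : coord (c e) @` dom (c e) = zero_locus (S e) := svalP (S_ e).
  pose c' : chart (pow_atlas E a) := c.
  pose iota e (t : coord_index (c e)) : coord_index c' :=
    Tagged (fun e => coord_index (c e)) t.
  exists [set p | forall x, dom c' x -> peval p (coord c' x) = 0].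
  apply/seteqP; split=> [_ [x cx <-] p /(_ x cx)//|v Zv].
  have /choice[x xP] e : exists x, dom (c e) x /\ coord (c e) x = v \o @iota e.
    suff : zero_locus (S e) (v \o @iota e) by rewrite -SP => -[x]; exists x.
    move=> p Sp; have [q qP] := peval_rename (@iota e) p.
    rewrite -qP; apply: Zv => x /(_ e) cx; rewrite qP.
    suff : zero_locus (S e) (coord (c e) (x e)) by apply.
    by rewrite -SP; exists (x e).
  exists [ffun e => x e]; first by move=> e; rewrite ffunE; case: (xP e).
  apply: funext => -[e t] /=; rewrite ffunE (xP e).2 //.
- have := @pow_regular E E T T a a id (fun _ => id) (fun _ => variety_compat aV).
  by congr regular_on; apply: funext => x; apply/ffunP => e; rewrite ffunE.
Qed.

(** Both translations are multiplication along a slice of [X * X]: in a chart,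
    one group of variables is replaced by the constant coordinates of [u]. *)
Lemma translation_regular (X : algGroup k) (u : X) :
  regular_on (points_atlas X) (points_atlas X) setT (fun x => (u * x)%g) /\
  regular_on (points_atlas X) (points_atlas X) setT (fun x => (x * u)%g).
Proof.
have [i0 i0u] := variety_cover (points_variety X) u.
pose A := prod_atlas (points_atlas X) (points_atlas X).
have slice (i : chart (points_atlas X)) (l : chart A) (g : X -> X * X)
    (sigma : coord_index l -> {mpoly k[#|coord_index i|]}) :
    (forall y, dom i y -> dom l (g y)) ->
    (forall y t, coord l (g y) t = peval (sigma t) (coord i y)) ->
    forall (j : chart (points_atlas X)) x, dom i x -> dom j ((g x).1 * (g x).2)%g ->
    exists (P : coord_index j -> {mpoly k[#|coord_index i|]}) Q,
    peval Q (coord i x) != 0 /\ forall y, [set: X] y -> dom i y ->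
      peval Q (coord i y) != 0 -> dom j ((g y).1 * (g y).2)%g /\
      forall t, coord j ((g y).1 * (g y).2)%g t =
        peval (P t) (coord i y) / peval Q (coord i y).
  move=> lg sigmaE j x ix jx.
  have [P [Q [Qx PQ]]] := points_mul_regular (i := l) Logic.I (lg x ix) jx.
  have [Q' Q'P] := peval_subst sigma Q.
  have /choice[P' P'P] t := peval_subst sigma (P t).
  have gE y : coord l (g y) = (fun t => peval (sigma t) (coord i y)).
    exact: funext.
  exists P', Q'; rewrite Q'P -gE; split=> // y _ iy; rewrite Q'P -gE => Qy.
  have [jy yE] := PQ (g y) Logic.I (lg y iy) Qy; split=> // t.
  by rewrite yE P'P gE.
split=> i j x _ ix jx.
- apply: (slice i (i0, i) (fun y => (u, y)) (fun t => match t with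
    | inl t => (coord i0 u t)%:MP | inr t => 'X_(enum_rank t) end)) => //.
  by move=> y [t|t]; rewrite ?pevalX // /peval mevalC.
- apply: (slice i (i, i0) (fun y => (y, u)) (fun t => match t with
    | inl t => 'X_(enum_rank t) | inr t => (coord i0 u t)%:MP end)) => //.
  by move=> y [t|t]; rewrite ?pevalX // /peval mevalC.
Qed.

End Powers.

(** * Constructible sets and closed images *)

Section Tame.
Variables (k : closedFieldType) (T : Type) (a : atlas k T).
Hypothesis aV : is_variety a.

(** Constructible sets have this property, which is preserved by Boolean
    operations without any normal form.  Applied to the closure of [S] it
    says that a nonempty [S] contains a nonempty open part of that closure. *)
Definition tame (S : set T) : Prop :=
  forall Z, zariski_closed a Z -> Z !=set0 -> exists O,
    [/\ zariski_open a O, O `&` Z !=set0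
      & O `&` Z `<=` S \/ O `&` Z `<=` ~` S].

Definition zariski_closure (S : set T) : set T :=
  \bigcap_(Z in [set Z | zariski_closed a Z /\ S `<=` Z]) Z.

Lemma zariski_closure_closed S : zariski_closed a (zariski_closure S).
Proof. by apply: zariski_closed_bigcap => Z []. Qed.

Lemma sub_zariski_closure S : S `<=` zariski_closure S.
Proof. by move=> x Sx Z [_]; apply. Qed.

Lemma zariski_closure_min S Z :
  zariski_closed a Z -> S `<=` Z -> zariski_closure S `<=` Z.
Proof. by move=> cZ SZ x; apply. Qed.

Lemma zariski_open_meets_closure S O : zariski_open a O ->
  O `&` zariski_closure S !=set0 -> O `&` S !=set0.
Proof.
move=> oO [x [Ox Sx]]; apply: contrapT => /forallNP nOS.
suff : (~` O) x by apply.
apply: Sx; split; first exact/(zariski_openC a O).1.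
by move=> y Sy Oy; apply: (nOS y).
Qed.

Lemma tameC S : tame S -> tame (~` S).
Proof.
move=> tS Z cZ Z0; have [O [oO OZ dich]] := tS Z cZ Z0.
by exists O; split=> //; rewrite setCK; case: dich; [right|left].
Qed.

(** If the open set [O1] given by [S1] misses [S1] inside [Z], the closure of
    [O1 `&` Z] is the closed set on which [S2] has to be tested: an open set
    meeting this closure meets [O1 `&` Z] itself. *)
Lemma tameU S1 S2 : tame S1 -> tame S2 -> tame (S1 `|` S2).
Proof.
move=> t1 t2 Z cZ Z0; have [O1 [o1 [x O1Zx] [sub1|dis1]]] := t1 Z cZ Z0.
  by exists O1; split=> //; [exists x|left=> y /sub1; left].
have [||O2 [o2 O2Z dich]] := t2 (zariski_closure (O1 `&` Z)).
- exact: zariski_closure_closed.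
- by exists x; apply: sub_zariski_closure.
exists (O1 `&` O2); split; first exact: zariski_openI.
  have [y [O2y [O1y Zy]]] := zariski_open_meets_closure o2 O2Z.
  by exists y.
have sub y : ((O1 `&` O2) `&` Z) y -> (O2 `&` zariski_closure (O1 `&` Z)) y.
  by move=> [[O1y O2y] Zy]; split=> //; apply: sub_zariski_closure.
case: dich => [sub2|dis2]; [left|right] => y Oy; first by right; apply/sub2/sub.
case: (Oy) => -[O1y O2y] Zy [|]; first exact: dis1.
by apply: dis2; apply: sub.
Qed.

Lemma tameI S1 S2 : tame S1 -> tame S2 -> tame (S1 `&` S2).
Proof.
by move=> /tameC t1 /tameC t2; rewrite -[_ `&` _]setCK setCI; apply/tameC/tameU.
Qed.

Lemma tame_open S : zariski_open a S -> tame S.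
Proof.
move=> oS Z cZ [x Zx]; have [[y [Sy Zy]]|nSZ] := pselect (S `&` Z !=set0).
  by exists S; split=> //; [exists y|left=> ? []].
exists setT; split; [exact: zariski_openT|by exists x|right=> y [_ Zy] Sy].
by apply: nSZ; exists y.
Qed.

Lemma tame_bigcup (J : finType) (S : J -> set T) :
  (forall j, tame (S j)) -> tame (\bigcup_j S j).
Proof.
move=> tS; have -> : \bigcup_j S j = \big[setU/set0]_(j <- enum J) S j.
  by rewrite -bigcup_seq; apply: eq_bigcupl; split=> j _ //=; rewrite mem_enum.
elim/big_ind: _ => [|S1 S2 t1 t2|j _]; [|exact: tameU|exact: tS].
by apply: tame_open => x.
Qed.

(** The domain of a chart and the nonvanishing loci of polynomials in it are open;
    all other quantifier-free conditions are Boolean combinations of these. *)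
Lemma tame_qf (i : chart a) (f : GRing.formula k) :
  GRing.qf_form f -> GRing.rformula f ->
  tame [set x | dom i x /\ GRing.qf_eval (env (coord i x)) f].
Proof.
have tame_basic p : tame (basic_open i p).
  exact/tame_open/(basic_open_open aV).
have tame_dom : tame (dom i).
  have -> : dom i = basic_open i 1; last exact: tame_basic.
  apply/seteqP; split=> x; last by case.
  by split=> //; rewrite /peval meval1 oner_neq0.
pose E f := [set x | dom i x /\ GRing.qf_eval (env (coord i x)) f].
rewrite -/(E f); elim: f => //=.
- move=> b _ _; case: b.
    by have -> : E (GRing.Bool true) = dom i by apply/seteqP; split=> x //= [].
  have -> : E (GRing.Bool false) = set0 by apply/seteqP; split=> x //= [].
  by apply: tame_open => x.
- move=> t u _ /andP[rt ru].
  have [p pP] := mpoly_of_rterm (coord_index i) rt.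
  have [q qP] := mpoly_of_rterm (coord_index i) ru.
  have -> : E (GRing.Equal t u) = dom i `&` ~` basic_open i (p - q).
    rewrite /E /basic_open; apply/seteqP.
    split=> x /= [ix]; rewrite /peval mevalB -!/(peval _ _) pP qP subr_eq0.
      by move=> tu; split=> // -[_]; rewrite tu.
    by move=> ntu; split=> //; apply: contrapT => /negP tu; apply: ntu.
  by apply: tameI => //; apply: tameC.
- move=> f IHf g IHg /andP[qf qg] /andP[rf rg].
  have -> : E (GRing.And f g) = E f `&` E g.
    apply/seteqP; split=> x /=.
      by case=> ix /andP[fx gx].
    by case=> -[ix fx] [_ gx]; split=> //; rewrite /= fx.
  by apply: tameI; [apply: IHf|apply: IHg].
- move=> f IHf g IHg /andP[qf qg] /andP[rf rg].
  have -> : E (GRing.Or f g) = E f `|` E g.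
    apply/seteqP; split=> x /=.
      by case=> ix /orP[fx|gx]; [left|right].
    by case=> -[ix fx]; split=> //; rewrite /= fx ?orbT.
  by apply: tameU; [apply: IHf|apply: IHg].
- move=> f IHf g IHg /andP[qf qg] /andP[rf rg].
  have -> : E (GRing.Implies f g) = dom i `&` (~` E f `|` E g).
    apply/seteqP; split=> x /=.
      case=> ix /implyP fg; split=> //.
      have [gx|ngx] := pselect (GRing.qf_eval (env (coord i x)) g).
        by right.
      by left=> -[_ /fg].
    case=> ix [nfx|[_ gx]]; split=> //; apply/implyP => // fx.
    by case: nfx.
  by apply: tameI => //; apply: tameU; [apply/tameC/IHf|apply: IHg].
- move=> f IHf qf rf.
  have -> : E (GRing.Not f) = dom i `&` ~` E f.
    apply/seteqP; split=> x /= [ix].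
      by move=> /negP nfx; split=> // -[_].
    by move=> nfx; split=> //; apply/negP => fx; apply: nfx.
  by apply: tameI => //; apply/tameC/IHf.
Qed.

End Tame.

(** Let [C] be the closure of [H], a group by continuity of translations and
    inversion, and [O `&` C] a nonempty open part of [C] contained in [H].  For
    [c] in [C], the elements [x] of [C] with [x * c] in [O] form a nonempty open
    part of [C], so some [h] in [H] has [h * c] in [O `&` C], hence in [H], and
    then [c] is in [H]. *)
Lemma tame_subgroup_closed (k : closedFieldType) (V : groupType) (a : atlas k V)
    (aV : is_variety a)
    (mull : forall u : V, regular_on a a setT (fun x => (u * x)%g))
    (mulr : forall u : V, regular_on a a setT (fun x => (x * u)%g))
    (inv : regular_on a a setT (fun x : V => (x^-1)%g))
    (H : set V) :
  H 1%g -> (forall u v, H u -> H v -> H (u * v)%g) ->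
  (forall u, H u -> H (u^-1)%g) -> tame a H -> zariski_closed a H.
Proof.
move=> H1 HM HV tH; pose C := zariski_closure a H.
have cC : zariski_closed a C by exact: zariski_closure_closed.
have HC : H `<=` C by exact: sub_zariski_closure.
have HCC u c : H u -> C c -> C (u * c)%g.
  move=> Hu; apply: (zariski_closure_min (Z := (fun x => u * x)%g @^-1` C)).
    exact (regular_continuous aV (mull u) cC).
  by move=> v Hv; exact: HC (HM _ _ Hu Hv).
have CCC c d : C c -> C d -> C (c * d)%g.
  move=> + Cd; apply: (zariski_closure_min (Z := (fun x => x * d)%g @^-1` C)).
    exact (regular_continuous aV (mulr d) cC).
  by move=> u Hu; apply: HCC.
have CV c : C c -> C (c^-1)%g.
  apply: (zariski_closure_min (Z := (fun x => x^-1)%g @^-1` C)).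
    exact (regular_continuous aV inv cC).
  by move=> u Hu; exact: HC (HV _ Hu).
have [O [oO OC OCH]] : exists O,
    [/\ zariski_open a O, O `&` C !=set0 & O `&` C `<=` H].
  have [|O [oO OC [OCH|OCH]]] := tH C cC; first by exists 1%g; apply: HC.
    by exists O.
  have [x [Ox Hx]] := zariski_open_meets_closure oO OC.
  by case: (OCH x) => //; split=> //; apply: HC.
suff -> : H = C by [].
apply/seteqP; split=> // c Cc; case: OC => u [Ou Cu].
have o' : zariski_open a ((fun x => x * c)%g @^-1` O).
  apply/zariski_openC.
  exact (regular_continuous aV (mulr c) ((zariski_openC a O).1 oO)).
have [|h [Och Hh]] := @zariski_open_meets_closure _ _ a H _ o'.
  exists (u * c^-1)%g; split; first by rewrite /= mulgVK.
  by apply: CCC => //; apply: CV.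
have Hhc : H (h * c)%g by apply: OCH; split=> //; apply: HCC.
by rewrite -(mulKg h c); apply: HM => //; apply: HV.
Qed.

Section Images.
Variables (k : closedFieldType) (E F : finType) (s : F -> E).

Definition relabel (T : Type) (x : {ffun E -> T}) : {ffun F -> T} :=
  [ffun h => x (s h)].

Lemma relabel_regular (T : Type) (a : atlas k T) : is_variety a ->
  regular_on (pow_atlas E a) (pow_atlas F a) setT (@relabel T).
Proof.
move=> aV; apply: (pow_regular (f := fun _ => id)) => _.
exact: variety_compat aV.
Qed.

(** Finite functions do not compute, so the chart of a relabelled pattern is only
    propositionally the original chart. *)
Lemma coord_transport (T : Type) (a : atlas k T) (i j : chart a) (ij : i = j)
    (x : T) (t : coord_index i) :
  coord j x (ecast j (coord_index j) ij t) = coord i x t.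
Proof. by case: j / ij. Qed.

(** In charts, relabelling is a coordinate projection, so that the image of
    each affine piece of [K] is the set described by [projection_qf]. *)
Lemma relabel_image_tame (T : Type) (a : atlas k T) (aV : is_variety a)
    (K : set {ffun E -> T}) :
  zariski_closed (pow_atlas E a) K -> tame (pow_atlas F a) (@relabel T @` K).
Proof.
move=> cK; have EV := pow_variety E aV; have FV := pow_variety F aV.
have -> : @relabel T @` K = \bigcup_(c : chart (pow_atlas E a))
    (@relabel T @` (K `&` dom c)).
  apply/seteqP; split=> [_ [x Kx <-]|_ [c _ [x [Kx _] <-]]]; last by exists x.
  by have [c cx] := variety_cover EV x; exists c => //; exists x.
apply: tame_bigcup => // c.
have [S1 S1P] := cK c; have [S2 S2P] := variety_coord_image EV c.
pose d : chart (pow_atlas F a) := [ffun h => c (s h)].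
have dE h : d h = c (s h) by rewrite ffunE.
pose iota (t : coord_index d) : coord_index c :=
  Tagged (fun e => coord_index (c e))
    (ecast j (coord_index j) (dE (tag t)) (tagged t)).
have coordE x : coord d (relabel x) = coord c x \o iota.
  apply: funext => -[h t] /=; rewrite coord_transport.
  by have -> : relabel x h = x (s h) by rewrite ffunE.
have [f [/andP[qf rf] fP]] := projection_qf iota (S1 `|` S2).
suff -> : @relabel T @` (K `&` dom c) =
    [set y | dom d y /\ GRing.qf_eval (env (coord d y)) f] by exact: tame_qf.
apply/seteqP; split=> [_ [x [Kx cx] <-]|y [dy /fP[v Zv yE]]].
  split; first by move=> h; rewrite dE /relabel ffunE.
  apply/fP; exists (coord c x) => // p [S1p|S2p].
    exact: ((S1P x cx).1 Kx).
  suff : zero_locus S2 (coord c x) by apply.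
  by rewrite -S2P; exists x.
have : zero_locus S2 v by move=> p S2p; apply: Zv; right.
rewrite -S2P => -[x cx xE]; exists x.
  split=> //; apply/(S1P x cx) => p S1p.
  by rewrite xE; apply: Zv; left.
apply: (variety_coord_inj FV (i := d)); rewrite ?in_setE //.
  by move=> h; rewrite dE /relabel ffunE.
by rewrite coordE xE yE.
Qed.

Lemma relabel_subgroup_closed (X : algGroup k) (K : set {ffun E -> X}) :
  algebraic_subgroup (pow_atlas E (points_atlas X)) K ->
  algebraic_subgroup (pow_atlas F (points_atlas X)) (@relabel X @` K).
Proof.
move=> [K1 KM KV cK]; have XV := points_variety X.
have relabelM (u v : {ffun E -> X}) :
    relabel (u * v)%g = (relabel u * relabel v)%g.
  by apply/ffunP => h; rewrite !ffunE.
have relabelV (u : {ffun E -> X}) : relabel (u^-1)%g = ((relabel u)^-1)%g.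
  by apply/ffunP => h; rewrite !ffunE.
have H1 : (@relabel X @` K) 1%g.
  by exists 1%g => //; apply/ffunP => h; rewrite !ffunE.
have HM u v : (@relabel X @` K) u -> (@relabel X @` K) v ->
    (@relabel X @` K) (u * v)%g.
  by move=> [x Kx <-] [y Ky <-]; exists (x * y)%g => //; apply: KM.
have HV u : (@relabel X @` K) u -> (@relabel X @` K) (u^-1)%g.
  by move=> [x Kx <-]; exists (x^-1)%g => //; apply: KV.
split=> //; apply: tame_subgroup_closed => //.
- exact: pow_variety.
- move=> u.
  have := pow_regular (s := id) (fun h : F => (translation_regular (u h)).1).
  by congr regular_on; apply: funext => x; apply/ffunP => h; rewrite !ffunE.
- move=> u.
  have := pow_regular (s := id) (fun h : F => (translation_regular (u h)).2).
  by congr regular_on; apply: funext => x; apply/ffunP => h; rewrite !ffunE.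
- have := pow_regular (s := id) (fun h : F => @points_inv_regular _ X).
  by congr regular_on; apply: funext => x; apply/ffunP => h; rewrite !ffunE.
- exact: relabel_image_tame.
Qed.

End Images.
Arguments relabel {E F} s {T} x.

Local Open Scope group_scope.

(** * Locality of the inverse *)

Section Patterns.
Variable G : monoidType.

Lemma eq_restr (A : Type) (E : {fset G}) (x y : G -> A) :
  restr E x = restr E y <-> {in E, x =1 y}.
Proof.
split=> [xy g gE|xy]; last by apply/ffunP => g; rewrite !ffunE xy ?fsvalP.
by have := congr1 (fun p : {ffun E -> A} => p [` gE]%fset) xy; rewrite !ffunE.
Qed.

Definition fset_mul (M N : {fset G}) : {fset G} :=
  [fset m * n | m in M, n in N]%fset.

Lemma mem_fset_mul (M N : {fset G}) m n :
  m \in M -> n \in N -> m * n \in fset_mul M N.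
Proof. by move=> mM nN; apply: in_imfset2. Qed.

Lemma restr_act (A : Type) (E : {fset G}) (g : G) (x : G -> A) (h : E) :
  restr E (act g x) h = x (val h * g).
Proof. by rewrite ffunE. Qed.

(** The sets of configurations with prescribed restriction to a finite set form
    a basis of neighbourhoods. *)
Lemma prodiscrete_closedP (A : choiceType) (Sigma : set (G -> A)) (x : G -> A) :
  prodiscrete_closed Sigma ->
  (forall E : {fset G}, (restr E @` Sigma) (restr E x)) -> Sigma x.
Proof.
move=> cS xS; apply: cS.
pose F : set_system {ptws G -> discrete_topology A} :=
  filter_from setT (fun E : {fset G} => [set y | restr E y = restr E x]).
have FF : Filter F.
  apply: filter_from_filter; first by exists fset0.
  move=> E1 E2 _ _; exists (E1 `|` E2)%fset => // y /= /eq_restr yx.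
  by split; apply/eq_restr => g gE; apply: yx; rewrite inE gE ?orbT.
have Fx : F --> (x : {ptws G -> discrete_topology A}).
  apply/cvg_sup => g B /= [_ [[C Cop <-] Cx sCB]].
  exists [fset g]%fset => // y /= /eq_restr yx; apply: sCB => /=.
  by rewrite yx // inE.
move=> B /Fx[E _ EB]; have [y Sy yx] := xS E.
by exists y; split=> //; apply: EB.
Qed.

Lemma countable_exhaustion : countable [set: G] ->
  exists N : nat -> {fset G},
    (forall m n, (m <= n)%N -> (N m `<=` N n)%fset) /\
    forall g, exists n, g \in N n.
Proof.
move=> /countable_injP[f finj].
have /choice[e eP] n : exists e : {fset G}, forall g, f g = n -> g \in e.
  have [[g <-]|nog] := pselect (exists g, f g = n).
    exists [fset g]%fset => h /finj; rewrite !in_setE !inE => ->//.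
  by exists fset0 => g fg; case: nog; exists g.
pose N n := iteri n (fun i S => (e i `|` S)%fset) fset0.
exists N; split=> [m n|g]; last first.
  by exists (f g).+1; rewrite /= inE eP.
move=> /subnK <-; elim: (n - m)%N => //= d IH.
exact: fsubset_trans IH (fsubsetUr _ _).
Qed.

End Patterns.

Section Kernel.
Variables (G : monoidType) (k : closedFieldType) (X Y : algGroup k).
Variables (Sigma : set (G -> X)) (tau : (G -> X) -> (G -> Y)).
Hypotheses (Sigma_alg : closed_alg_group_subshift Sigma).
Variables (M : {fset G}) (mu : {ffun M -> X} -> Y).
Hypotheses (tau_local : local_rule Sigma tau mu).
Hypothesis mu_hom : alg_group_hom_on (pow_atlas M (points_atlas X))
  (points_atlas Y) (@restr G X M @` Sigma) mu.

Lemma alg_subshift_mul x y : Sigma x -> Sigma y -> Sigma (fun g => x g * y g).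
Proof.
move=> Sx Sy; have [_ cS SE] := Sigma_alg.
apply: (prodiscrete_closedP cS) => E; have [_ SM _ _] := SE E.
have -> : restr E (fun g => x g * y g) = restr E x * restr E y.
  by apply/ffunP => g; rewrite !ffunE.
by apply: SM; [exists x|exists y].
Qed.

Lemma alg_subshift_inv x : Sigma x -> Sigma (fun g => (x g)^-1).
Proof.
move=> Sx; have [_ cS SE] := Sigma_alg.
apply: (prodiscrete_closedP cS) => E; have [_ _ SV _] := SE E.
have -> : restr E (fun g => (x g)^-1) = (restr E x)^-1.
  by apply/ffunP => g; rewrite !ffunE.
by apply: SV; exists x.
Qed.

Lemma alg_subshift_one : Sigma (fun _ => 1).
Proof.
have [_ cS SE] := Sigma_alg; apply: (prodiscrete_closedP cS) => E.
have [S1 _ _ _] := SE E.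
suff -> : restr E (fun _ => 1 : X) = 1 by [].
by apply/ffunP => g; rewrite !ffunE.
Qed.

Lemma alg_ca_mul x y : Sigma x -> Sigma y ->
  forall g, tau (fun h => x h * y h) g = tau x g * tau y g.
Proof.
move=> Sx Sy g; have [Sinv _ _] := Sigma_alg.
rewrite !tau_local //; last exact: alg_subshift_mul.
rewrite -mu_hom.2; [|by eexists; [exact: Sinv Sx|]|by eexists; [exact: Sinv Sy|]].
by congr mu; apply/ffunP => h; rewrite !ffunE.
Qed.

Lemma alg_ca_one g : tau (fun _ => 1) g = 1.
Proof.
have /= := alg_ca_mul alg_subshift_one alg_subshift_one g.
have -> : (fun _ : G => 1 * 1 : X) = (fun _ => 1).
  by apply: funext => h; rewrite mulg1.
by move=> H; apply: (mulgI (tau (fun _ => 1) g)); rewrite -H mulg1.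
Qed.

Lemma alg_ca_inv x : Sigma x -> forall g, tau (fun h => (x h)^-1) g = (tau x g)^-1.
Proof.
move=> Sx g; apply: (mulgI (tau x g)); rewrite mulgV -(alg_ca_one g).
rewrite -(alg_ca_mul Sx (alg_subshift_inv Sx)); congr (tau _ g).
by apply: funext => h; rewrite mulgV.
Qed.

Definition kernel_on (N : {fset G}) : set (G -> X) :=
  [set x | Sigma x /\ {in N, forall g, tau x g = 1}].

(** The values of [tau x] on [N] only depend on [x] on this set; [N] and [1] are
    added so that the windows exhaust [G] and always see the coordinate at
    which kernel elements are tested. *)
Definition window (N : {fset G}) : {fset G} :=
  (N `|` (1 |` fset_mul M N))%fset.

Lemma window_mul N m g : m \in M -> g \in N -> m * g \in window N.
Proof. by move=> mM gN; rewrite !inE mem_fset_mul ?orbT. Qed.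

Lemma windowS N1 N2 : (N1 `<=` N2)%fset -> (window N1 `<=` window N2)%fset.
Proof.
move=> /fsubsetP N12; apply/fsubsetP => g; rewrite !inE.
case/or3P=> [/N12->//|->|/imfset2P[m mM [h hN ->]]]; rewrite ?orbT //.
by rewrite mem_fset_mul ?orbT //; apply: N12.
Qed.

(** The condition [tau x g = 1] says that the pattern of [x] around [g] lies in
    the kernel of [mu], a closed set because points are closed. *)
Lemma kernel_pattern_subgroup N :
  algebraic_subgroup (pow_atlas (window N) (points_atlas X))
    (restr (window N) @` kernel_on N).
Proof.
have [Sinv cS SE] := Sigma_alg; set E := window N.
have [S1 SM SV cSE] := SE E; split.
- exists (fun _ => 1).
    by split=> [|g _]; [exact: alg_subshift_one|exact: alg_ca_one].
  by apply/ffunP => g; rewrite !ffunE.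
- move=> _ _ [x [Sx tx] <-] [y [Sy ty] <-]; exists (fun g => x g * y g).
    split=> [|g gN]; first exact: alg_subshift_mul.
    by rewrite alg_ca_mul // tx // ty // mulg1.
  by apply/ffunP => g; rewrite !ffunE.
- move=> _ [x [Sx tx] <-]; exists (fun g => (x g)^-1).
    split=> [|g gN]; first exact: alg_subshift_inv.
    by rewrite alg_ca_inv // tx // invg1.
  by apply/ffunP => g; rewrite !ffunE.
have EV := pow_variety E (points_variety X).
have MV := pow_variety M (points_variety X).
pose Z0 := (restr M @` Sigma) `&` mu @^-1` [set 1].
have cZ0 : zariski_closed (pow_atlas M (points_atlas X)) Z0.
  apply: (regular_preimage_closed (points_variety Y) mu_hom.1).
    by have [] := SE M.
  exact/zariski_closed1/points_variety.
pose r (g : N) (h : M) : E := [` window_mul (fsvalP h) (fsvalP g)]%fset.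
have rE g x : relabel (r g) (restr E x) = restr M (act (val g) x).
  by apply/ffunP => h; rewrite !ffunE.
have -> : restr E @` kernel_on N =
    (restr E @` Sigma) `&` \bigcap_(g in [set: N]) (relabel (r g) @^-1` Z0).
  apply/seteqP; split=> [_ [x [Sx tx] <-]|_ [[x Sx <-] xZ]].
    split=> [|g _]; first by exists x.
    rewrite /preimage /= rE; split.
      by exists (act (val g) x) => //; apply: Sinv.
    by rewrite /= -tau_local // tx // fsvalP.
  exists x => //; split=> // g gN.
  by have [_] := xZ [` gN]%fset I; rewrite /preimage /= rE /= -tau_local.
apply: zariski_closedI => //; apply: zariski_closed_bigcap => g _.
exact (regular_continuous MV (relabel_regular (s := r g) (points_variety X)) cZ0).
Qed.

Lemma kernel_onS (N1 N2 : {fset G}) :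
  (N1 `<=` N2)%fset -> kernel_on N2 `<=` kernel_on N1.
Proof. by move=> /fsubsetP N12 x [Sx tx]; split=> // g /N12/tx. Qed.

(** The Mittag-Leffler condition: a pattern on the [n]-th window that comes from
    the [m]-th group of the tower comes from all of them. *)
Lemma kernel_pattern_stable (N : nat -> {fset G}) :
  (forall m n, (m <= n)%N -> (N m `<=` N n)%fset) ->
  forall n, exists2 m, (n <= m)%N & forall p x, kernel_on (N m) x ->
    exists2 y, kernel_on (N p) y & restr (window (N n)) y = restr (window (N n)) x.
Proof.
move=> Nmono n; pose E := window (N n).
(* Indices start at [n], where the window of the group contains [E]. *)
pose Z m := restr E @` kernel_on (N (n + m)%N).
have cZ m : zariski_closed (pow_atlas E (points_atlas X)) (Z m).
  have sub : (E `<=` window (N (n + m)%N))%fset by exact/windowS/Nmono/leq_addr.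
  have [_ _ _] := relabel_subgroup_closed (fincl sub)
    (kernel_pattern_subgroup (N (n + m)%N)).
  rewrite /Z; have -> : restr E = relabel (fincl sub) \o @restr G X _.
    by apply: funext => x; apply/ffunP => g; rewrite !ffunE.
  by rewrite image_comp.
have decZ m : Z m.+1 `<=` Z m.
  by apply: image_subset; apply/kernel_onS/Nmono; rewrite addnS.
have [m mP] := zariski_dcc (pow_variety E (points_variety X)) cZ decZ.
exists (n + m)%N => [|p x Kx]; first exact: leq_addr.
have [lepm|ltmp] := leqP p (n + m)%N.
  by exists x => //; apply: kernel_onS Kx; apply: Nmono.
have lenp : (n <= p)%N by apply: leq_trans (leq_addr m n) (ltnW ltmp).
have lep : (m <= p - n)%N by rewrite leq_subRL // ltnW.
have [|y Ky yx] := mP _ lep (restr E x); first by exists x.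
by exists y => //; move: Ky; rewrite subnKC.
Qed.

Hypothesis G_countable : countable [set: G].
Hypothesis tau_inj : set_inj Sigma tau.

(** If the tower never forced [x 1 = 1], start from a bad [x0] far up the tower
    and use stability to replace it successively by elements further and
    further up that agree with it on larger and larger windows.  The limit
    belongs to [Sigma], which is closed, it lies in the kernel of [tau], and
    it is nontrivial at [1]. *)
Lemma kernel_local : exists N : {fset G}, forall x, kernel_on N x -> x 1 = 1.
Proof.
have [N [Nmono Nex]] := countable_exhaustion G_countable.
apply: contrapT => /forallNP noN.
have /choice[s sP] n : exists m, (n <= m)%N /\ forall p x, kernel_on (N m) x ->
    exists2 y, kernel_on (N p) y & restr (window (N n)) y = restr (window (N n)) x.
  by have [m lenm mP] := kernel_pattern_stable Nmono n; exists m.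
have /existsNP[x0 /not_implyP[Kx0 x0_neq1]] := noN (N (s 0%N)).
(* The first component counts the steps, so that a choice of successors is
   enough; the stages reached are the [s n], where [kernel_pattern_stable]
   allows the pattern on the [n]-th window to be kept. *)
have step (nx : nat * (G -> X)) : {ny : nat * (G -> X) | ny.1 = nx.1.+1 /\
    (kernel_on (N (s nx.1)) nx.2 -> kernel_on (N (s nx.1.+1)) ny.2 /\
     restr (window (N nx.1)) ny.2 = restr (window (N nx.1)) nx.2)}.
  apply: cid; case: nx => n x /=.
  have [Kx|nKx] := pselect (kernel_on (N (s n)) x); last by exists (n.+1, x).
  by have [y Ky yx] := (sP n).2 (s n.+1) x Kx; exists (n.+1, y).
have [f [f0 fS]] := dependent_choice step (0%N, x0).
have f1 n : (f n).1 = n by elim: n => [|n IH]; [rewrite f0|rewrite (fS n).1 IH].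
pose x n := (f n).2.
have Kx n : kernel_on (N (s n)) (x n).
  elim: n => [|n IH]; first by rewrite /x f0.
  by have [_] := fS n; rewrite f1 => /(_ IH)[].
have xS n : restr (window (N n)) (x n.+1) = restr (window (N n)) (x n).
  by have [_] := fS n; rewrite f1 => /(_ (Kx n))[].
have xD m n : (m <= n)%N -> {in window (N m), x n =1 x m}.
  move=> /subnK <-; elim: (n - m)%N => // d IH g gm.
  rewrite addSn -IH //; apply: ((eq_restr _ _ _).1 (xS _)).
  by apply: fsubsetP gm; apply/windowS/Nmono/leq_addl.
have /choice[r rP] g : exists n, g \in N n by exact: Nex.
pose z g := x (r g) g.
have winN n g : g \in N n -> g \in window (N n) by move=> gN; rewrite inE gN.
have zx n : {in window (N n), z =1 x n}.
  move=> g gn; have [le_rn|lt_nr] := leqP (r g) n.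
    by rewrite /z (xD _ _ le_rn) //; apply: winN.
  by rewrite /z (xD _ _ (ltnW lt_nr)).
have Sz : Sigma z.
  have [_ cS _] := Sigma_alg; apply: (prodiscrete_closedP cS) => E.
  have [n nP] : exists n, (E `<=` N n)%fset.
    exists (\max_(g : E) r (val g)); apply/fsubsetP => g gE.
    apply: fsubsetP (rP g); apply: Nmono.
    exact: (@leq_bigmax _ (fun g : E => r (val g)) [` gE]%fset).
  exists (x n); first by case: (Kx n).
  by apply/eq_restr => g /(fsubsetP nP)/winN/zx.
have tz g : tau z g = 1.
  have [Sx tx] := Kx (r g).
  rewrite -(tx g); last by apply: fsubsetP (rP g); apply: Nmono; case: (sP (r g)).
  rewrite !tau_local //; congr mu; apply/ffunP => m; rewrite !restr_act.
  by apply: zx; apply: window_mul => //; apply: fsvalP.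
have z1 : z = (fun _ => 1).
  apply: tau_inj; rewrite ?in_setE //; first exact: alg_subshift_one.
  by apply: funext => g; rewrite tz alg_ca_one.
apply: x0_neq1; have : x 0%N = x0 by rewrite /x f0.
move=> <-; rewrite -(zx 0%N) ?z1 //.
by rewrite !inE eqxx orbT.
Qed.

Lemma inverse_local : exists N : {fset G}, forall x y, Sigma x -> Sigma y ->
  {in N, tau x =1 tau y} -> x 1 = y 1.
Proof.
have [N NP] := kernel_local; exists N => x y Sx Sy xy.
have := NP (fun g => x g * (y g)^-1); move=> H; apply/divg1_eq/H; split.
  exact/alg_subshift_mul/alg_subshift_inv.
move=> g gN; rewrite alg_ca_mul //; last exact: alg_subshift_inv.
by rewrite alg_ca_inv // xy // mulgV.
Qed.

End Kernel.

(** * Images of subshifts under reversible automata *)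

Section SymbolicDynamics.
Variable G : monoidType.

Definition ca_map (A B : Type) (M : {fset G}) (mu : {ffun M -> A} -> B)
    (x : G -> A) : G -> B :=
  fun g => mu (restr M (act g x)).

Lemma actM (A : Type) (g h : G) (x : G -> A) : act h (act g x) = act (h * g) x.
Proof. by apply: funext => t; rewrite /act mulgA. Qed.

Lemma act1 (A : Type) (x : G -> A) : act 1 x = x.
Proof. by apply: funext => t; rewrite /act mulg1. Qed.

Lemma ca_map_act (A B : Type) (M : {fset G}) (mu : {ffun M -> A} -> B) g x :
  ca_map mu (act g x) = act g (ca_map mu x).
Proof. by apply: funext => h; rewrite /ca_map actM. Qed.

Lemma ca_map_window (A B : Type) (M N : {fset G}) (mu : {ffun M -> A} -> B) x y :
  {in fset_mul M N, x =1 y} -> {in N, ca_map mu x =1 ca_map mu y}.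
Proof.
move=> xy n nN; congr mu; apply/eq_restr => m mM.
by apply: xy; apply: mem_fset_mul.
Qed.

(** Forbidden patterns of different shapes can be combined once the set of
    allowed patterns is replaced by a property depending on finitely many
    coordinates. *)
Lemma is_sftP (A : Type) (Sigma : set (G -> A)) :
  is_sft Sigma <-> exists (D : {fset G}) (Q : set (G -> A)),
    (forall x y, {in D, x =1 y} -> Q x -> Q y) /\
    Sigma = [set x | forall g, Q (act g x)].
Proof.
split=> [[D [P ->]]|[D [Q [Qloc ->]]]].
  exists D, (@restr G A D @^-1` P); split=> // x y xy.
  by rewrite /preimage /= ((eq_restr D x y).2 xy).
exists D, (restr D @` Q); apply/seteqP; split=> x xQ g.
  by exists (act g x).
by have [y Qy /eq_restr yx] := xQ g; apply: Qloc Qy.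
Qed.

(** A configuration [y] is in the image exactly when [nu] sends it into [Delta]
    and [mu] sends the result back to [y]; in both cases the condition at [g] is
    a condition at [1] on the translate of [y] by [g]. *)
Lemma sft_image (A B : Type) (M N : {fset G}) (mu : {ffun M -> A} -> B)
    (nu : {ffun N -> B} -> A) (Delta : set (G -> A)) :
  (forall x, Delta x -> ca_map nu (ca_map mu x) = x) ->
  is_sft Delta -> is_sft (ca_map mu @` Delta).
Proof.
move=> nu_mu /is_sftP[D [Q [Qloc DeltaE]]]; apply/is_sftP.
exists (1%g |` fset_mul N (D `|` M))%fset,
  [set y | Q (ca_map nu y) /\ ca_map mu (ca_map nu y) 1 = y 1].
split=> [x y xy [Qx x1]|].
  have nu_xy : {in (D `|` M)%fset, ca_map nu x =1 ca_map nu y}.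
    by apply: ca_map_window => g gN; apply: xy; rewrite inE gN orbT.
  split; first by apply: Qloc Qx => g gD; apply: nu_xy; rewrite inE gD.
  rewrite -xy ?inE ?eqxx // -x1 /ca_map !act1; congr mu; apply/eq_restr => g gM.
  by apply/esym/nu_xy; rewrite inE gM orbT.
have actE g (y : G -> B) : act g y 1 = y g by rewrite /act mul1g.
apply/seteqP; split=> [_ [x Dx <-] g|y yQ] /=.
  rewrite !ca_map_act nu_mu //; split=> //.
  by move: Dx; rewrite DeltaE; apply.
have Qy g := (yQ g).1; have yE g := (yQ g).2.
exists (ca_map nu y).
  by rewrite DeltaE => g; rewrite /= -ca_map_act.
by apply: funext => g; have := yE g; rewrite !ca_map_act !actE.
Qed.

Lemma sofic_image (A B : Type) (M : {fset G}) (mu : {ffun M -> A} -> B)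
    (Delta : set (G -> A)) :
  sofic Delta -> sofic (ca_map mu @` Delta).
Proof.
move=> [C [S [tau [S_sft [N [nu tauE]] ->]]]].
exists C, S, (ca_map mu \o tau); split=> //; last by rewrite image_comp.
have NM (n : N) (m : M) : val n * val m \in fset_mul N M.
  by apply: mem_fset_mul; apply: fsvalP.
exists (fset_mul N M), (fun p => mu [ffun m => nu [ffun n => p [` NM n m]%fset]]).
move=> x Sx g; rewrite /= /ca_map; congr mu; apply/ffunP => m.
rewrite !ffunE /act tauE //; congr nu; apply/ffunP => n.
by rewrite !ffunE /act mulgA.
Qed.

Lemma ca_conjugacy (A B : Type) (M N : {fset G}) (mu : {ffun M -> A} -> B)
    (nu : {ffun N -> B} -> A) (Delta : set (G -> A)) :
  (forall x, Delta x -> ca_map nu (ca_map mu x) = x) ->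
  (is_sft (ca_map mu @` Delta) <-> is_sft Delta) /\
  (sofic (ca_map mu @` Delta) <-> sofic Delta).
Proof.
move=> nu_mu.
have DeltaE : ca_map nu @` (ca_map mu @` Delta) = Delta.
  apply/seteqP; split=> [_ [_ [x Dx <-] <-]|x Dx]; first by rewrite nu_mu.
  by exists (ca_map mu x); [exists x|exact: nu_mu].
split; split.
- rewrite -{2}DeltaE; apply: sft_image => _ [x Dx <-].
  by rewrite nu_mu.
- exact: sft_image nu_mu.
- by rewrite -{2}DeltaE; apply: sofic_image.
- exact: sofic_image.
Qed.

End SymbolicDynamics.

Theorem theorem10p1 (G : monoidType) (G_countable : countable [set: G])
    (k : closedFieldType) (X Y : algGroup k)
    (Sigma : set (G -> X)) (tau : (G -> X) -> (G -> Y))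
    (Sigma_alg : closed_alg_group_subshift Sigma)
    (tau_alg : alg_group_cellular_automaton Sigma tau)
    (tau_inj : set_inj Sigma tau)
    (Delta : set (G -> X))
    (Delta_subshift : subshift Delta)
    (Delta_sub : Delta `<=` Sigma) :
  (is_sft (tau @` Delta) <-> is_sft Delta) /\
  (sofic (tau @` Delta) <-> sofic Delta).
Proof.
have [M [mu [tau_local mu_hom]]] := tau_alg.
have [Sigma_act _ _] := Sigma_alg.
have tauE x : Sigma x -> tau x = ca_map mu x.
  by move=> Sx; apply: funext => g; apply: tau_local.
have [N NP] := inverse_local Sigma_alg tau_local mu_hom G_countable tau_inj.
(* Patterns outside the image of [Sigma] receive the value [1]. *)
have /choice[nu nuP] (q : {ffun N -> Y}) : exists a : X,
    forall x, Sigma x -> restr N (tau x) = q -> x 1 = a.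
  have [[x [Sx <-]]|noq] := pselect (exists x, Sigma x /\ restr N (tau x) = q).
    by exists (x 1) => y Sy /eq_restr yx; apply: NP.
  by exists 1 => x Sx xq; case: noq; exists x.
have -> : tau @` Delta = ca_map mu @` Delta.
  by apply: eq_imagel => x /Delta_sub/tauE.
apply: (ca_conjugacy (nu := nu)) => x /Delta_sub Sx; apply: funext => g.
rewrite /ca_map -/(ca_map mu x) -ca_map_act -tauE; last exact: Sigma_act.
by rewrite -(nuP _ (act g x)) ?/act ?mul1g //; apply: Sigma_act.
Qed.
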